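(* Assume the Continuum Hypothesis. Then for every real number $s \in (0,1]$ there exists a Hamel basis $B$ of $\mathbb{R}$ over $\mathbb{Q}$ (that is, a subset $B \subseteq \mathbb{R}$ that is linearly independent over $\mathbb{Q}$ and whose $\mathbb{Q}$-linear span is all of $\mathbb{R}$) such that the Hausdorff dimension of $B$ satisfies $\dim_H(B) = s$.
   Context: The Continuum Hypothesis is the statement $|\mathcal{P}(\mathbb{N})| = |\mathbb{R}| = \aleph_1$, i.e., the continuum has the cardinality of the first uncountable ordinal $\omega_1$. The axiom of choice (ZFC) is assumed. $\dim_H$ denotes the Hausdorff dimension of a subset of $\mathbb{R}$. *)

(* Defs.v *)
From HB Require Import structures.
From mathcomp Require Import all_boot all_order all_algebra.
From mathcomp Require Import all_classical all_reals all_analysis.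
From mathcomp Require Import Rstruct Rstruct_topology.
From Stdlib Require Import Rdefinitions.
Notation R := Rdefinitions.R.
Set Implicit Arguments. Unset Strict Implicit. Unset Printing Implicit Defensive.
Import Order.TTheory GRing.Theory Num.Theory.
Local Open Scope classical_set_scope.
Local Open Scope ring_scope.

(* Continuum Hypothesis (Cantor's form, equivalent under AC to |R| = aleph_1):
   every subset of R is either countable or equinumerous with R. *)
Definition CH : Prop :=
  forall A : set R, countable A \/ (A #= [set: R])%card.

Definition Q_lin_indep (B : set R) : Prop :=
  forall (s : seq R) (c : R -> rat),
    uniq s -> (forall x, x \in s -> B x) ->
    \sum_(x <- s) (ratr (c x) : R) * x = 0 ->
    forall x, x \in s -> c x = 0.

Definition Q_spans (B : set R) : Prop :=
  forall y : R, exists (s : seq R) (c : R -> rat),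
    (forall x, x \in s -> B x) /\ y = \sum_(x <- s) (ratr (c x) : R) * x.

Definition hamel_basis (B : set R) : Prop := Q_lin_indep B /\ Q_spans B.

Local Open Scope ereal_scope.

Definition diam (U : set R) : \bar R :=
  ereal_sup [set (`|x - y|)%:E | x in U & y in U].

Definition diam_pow (s : R) (U : set R) : \bar R :=
  if pselect (U = set0) then 0
  else match diam U with
       | (d%:E) => (powR d s)%:E
       | _ => +oo
       end.

Definition hausdorff_content (s delta : R) (A : set R) : \bar R :=
  ereal_inf [set \sum_(i <oo) diam_pow s (U i) | U in
    [set U : nat -> set R | A `<=` \bigcup_i U i /\ forall i, diam (U i) <= delta%:E]].

Definition hausdorff_measure (s : R) (A : set R) : \bar R :=
  ereal_sup [set hausdorff_content s delta A | delta in [set delta : R | (0 < delta)%R]].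

Definition hausdorff_dim (A : set R) : \bar R :=
  ereal_inf [set s%:E | s in [set s : R | (0 <= s)%R /\ hausdorff_measure s A = 0]].

(* Main.v *)
(** Give each bit sequence [a] the real number whose binary digits list [a] in order at
    a set of free positions of density [s], every other digit being determined by the
    part of [a] already listed. These reals form a set of dimension [s]: reading [a] back
    as a binary expansion maps the set onto [0, 1[ and is Hoelder of every exponent
    [t < s], while the prefixes of [a] give economical dyadic covers. Sparse blocks of
    non-free positions carry tags: the block attached to a word [w] contains one isolated
    digit [1] if [w] is a prefix of [a], and only zeros otherwise. When a vanishing integer
    combination is multiplied by the power of 2 pointing at a suitable block, a single
    term survives modulo 1, so the set is linearly independent over the rationals.
    Finally [0, 1[ lies in the sum of two sets of dimension 0 (digits supported on a set of
    positions, respectively on its complement, both with huge gaps), and a basis chosen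
    between the independent set and its union with these two has dimension [s]. *)
Require Import Defs.
From HB Require Import structures.
From mathcomp Require Import all_boot all_order all_algebra.
From mathcomp Require Import all_classical all_reals all_analysis.
From mathcomp Require Import Rstruct Rstruct_topology.
From Stdlib Require Import Rdefinitions.
From mathcomp Require Import ssrnat zify ring lra.
Import Order.TTheory GRing.Theory Num.Theory.
Local Open Scope classical_set_scope.
Local Open Scope ring_scope.
(* Otherwise numerals in arguments of type [R] denote Stdlib's [IZR] constants. *)
Bind Scope ring_scope with Rdefinitions.R.

(** * Binary expansions *)

(** Digit [0] is the most significant one, so this is the dyadic truncation at precision [m], and
    comparisons of reals reduce to comparisons of integers. *)
Fixpoint prefix_num (d : nat -> bool) (m : nat) : nat :=
  if m is k.+1 then (prefix_num d k).*2 + d k else 0.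

Lemma prefix_num_inj (d e : nat -> bool) (m : nat) :
  prefix_num d m = prefix_num e m -> forall i, (i < m)%N -> d i = e i.
Proof.
elim: m => //= m IH h i; rewrite ltnS leq_eqVlt => /orP[/eqP->|]; last first.
  by apply: IH; case: (d m) (e m) h => -[]; lia.
by case: (d m) (e m) h => -[]; lia.
Qed.

Lemma prefix_num_lt (d : nat -> bool) (m : nat) : (prefix_num d m < 2 ^ m)%N.
Proof. by elim: m => //= m IH; rewrite expnS; case: (d m) => /=; lia. Qed.

Lemma prefix_numD (d : nat -> bool) (m k : nat) :
  (prefix_num d m * 2 ^ k <= prefix_num d (m + k))%N /\
  (prefix_num d (m + k) < (prefix_num d m).+1 * 2 ^ k)%N.
Proof.
elim: k => [|k [IH1 IH2]]; first by rewrite addn0; lia.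
by rewrite addnS /= expnS; case: (d (m + k)%N) => /=; lia.
Qed.

Lemma prefix_num_zeros (d : nat -> bool) (m k : nat) :
  (forall i, (i < k)%N -> d (m + i)%N = false) ->
  prefix_num d (m + k) = (prefix_num d m * 2 ^ k)%N.
Proof.
elim: k => [|k IH] h; first by rewrite addn0 muln1.
rewrite addnS /= h // IH ?expnS; first by lia.
by move=> i ik; apply: h; lia.
Qed.

Definition bin_val (d : nat -> bool) : R :=
  sup [set (prefix_num d m)%:R / 2 ^+ m | m in [set: nat]].

Lemma exp2_gt0 (m : nat) : 0 < 2 ^+ m :> R.
Proof. by rewrite exprn_gt0. Qed.

(** Digits past a given precision contribute at most one unit of its last place. This bounds the set
    under the supremum in [bin_val] from above. *)
Lemma prefix_num_cross (d : nat -> bool) (m k : nat) :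
  (prefix_num d k)%:R / 2 ^+ k <= (prefix_num d m).+1%:R / 2 ^+ m :> R.
Proof.
rewrite ler_pdivrMr ?exp2_gt0 // mulrAC ler_pdivlMr ?exp2_gt0 //.
rewrite -!natrX -!natrM ler_nat.
have [km|/ltnW mk] := leqP k m.
  have [h _] := prefix_numD d k (m - k); rewrite subnKC // in h.
  have -> : (2 ^ m = 2 ^ (m - k) * 2 ^ k)%N by rewrite -expnD subnK.
  rewrite mulnA; apply: leq_mul => //; lia.
have [_ h] := prefix_numD d m (k - m); rewrite subnKC // in h.
have -> : (2 ^ k = 2 ^ (k - m) * 2 ^ m)%N by rewrite -expnD subnK.
by rewrite mulnA; apply: leq_mul => //; lia.
Qed.

Lemma bin_val_ge (d : nat -> bool) (m : nat) :
  (prefix_num d m)%:R <= bin_val d * 2 ^+ m.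
Proof.
rewrite -ler_pdivrMr ?exp2_gt0 //; apply: ub_le_sup; last by exists m.
by exists ((prefix_num d 0).+1%:R / 2 ^+ 0) => _ [k _ <-]; exact: prefix_num_cross.
Qed.

Lemma bin_val_le (d : nat -> bool) (m : nat) :
  bin_val d * 2 ^+ m <= (prefix_num d m)%:R + 1.
Proof.
rewrite -ler_pdivlMr ?exp2_gt0 //; apply: ge_sup; first by exists 0, 0%N; rewrite //= mul0r.
by move=> _ [k _ <-]; rewrite natr1; exact: prefix_num_cross.
Qed.

Lemma near_dyadic_eq (c x y : R) :
  (forall m : nat, `|x - y| * 2 ^+ m <= c) -> x = y.
Proof.
move=> h; apply/eqP; rewrite -subr_eq0 -normr_eq0.
apply/negPn/negP => ne; have d0 : 0 < `|x - y| by rewrite lt0r ne normr_ge0.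
have := @upper_nthrootP _ (c / `|x - y|) _ (leqnn _).
by rewrite ltr_pdivrMr // mulrC; apply/negP; rewrite -leNgt.
Qed.

Lemma bin_val_dist (d e : nat -> bool) (m : nat) :
  prefix_num d m = prefix_num e m -> `|bin_val d - bin_val e| * 2 ^+ m <= 1.
Proof.
move=> h; rewrite -[2 ^+ m]ger0_norm ?exprn_ge0 // -normrM ler_norml.
have := bin_val_ge d m; have := bin_val_le d m.
have := bin_val_ge e m; have := bin_val_le e m; rewrite h; lra.
Qed.

Definition bin_digits (y : R) (n : nat) : bool := odd (Num.truncn (y * 2 ^+ n.+1)).

Lemma prefix_num_digits (y : R) (m : nat) : 0 <= y < 1 ->
  prefix_num (bin_digits y) m = Num.truncn (y * 2 ^+ m).
Proof.
move=> /andP[y0 y1]; elim: m => [|m IH] /=.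
  by rewrite expr0 mulr1; apply/esym/truncn_def; rewrite y0.
rewrite IH /bin_digits.
have x0 : 0 <= y * 2 ^+ m by rewrite mulr_ge0 ?exprn_ge0.
have x0' : 0 <= y * 2 ^+ m.+1 by rewrite mulr_ge0 ?exprn_ge0.
set u := Num.truncn (y * 2 ^+ m.+1).
have -> : Num.truncn (y * 2 ^+ m) = u./2.
  apply/truncn_def; have /andP[] := truncn_itv x0'; rewrite -/u.
  rewrite exprS mulrCA => h1 h2.
  have := odd_double_half u; rewrite -muln2 => /(congr1 (fun k : nat => k%:R : R)).
  rewrite natrD natrM => hu; rewrite -(natr1 u) in h2; rewrite -(natr1 u./2).
  have o0 : 0 <= (odd u)%:R :> R by rewrite ler0n.
  apply/andP; split; first lra.
  have : (u.+1 <= (u./2 + 1) * 2)%N by have := odd_double_half u; case: (odd u); lia.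
  rewrite -(ler_nat R) -(natr1 u) natrM natrD; lra.
by rewrite addnC odd_double_half.
Qed.

Lemma bin_digitsK (y : R) : 0 <= y < 1 -> bin_val (bin_digits y) = y.
Proof.
move=> y01; have /andP[y0 y1] := y01; apply: (@near_dyadic_eq 1) => m.
have x0 : 0 <= y * 2 ^+ m by rewrite mulr_ge0 ?exprn_ge0.
rewrite -[2 ^+ m]ger0_norm ?exprn_ge0 // -normrM ler_norml.
have := bin_val_ge (bin_digits y) m; have := bin_val_le (bin_digits y) m.
rewrite prefix_num_digits //; have /andP[] := truncn_itv x0; rewrite -(natr1 (Num.truncn _)). lra.
Qed.

(** Disjoint supports produce no carries, so truncations add exactly and only rounding errors of at
    most two units remain. *)
Lemma bin_val_split (T e : nat -> bool) :
  bin_val (fun n => T n && e n) + bin_val (fun n => ~~ T n && e n) = bin_val e.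
Proof.
apply: (@near_dyadic_eq 2) => m.
set d1 := fun n => T n && e n; set d2 := fun n => ~~ T n && e n.
have /(congr1 (fun k : nat => k%:R : R)) : (prefix_num d1 m + prefix_num d2 m = prefix_num e m)%N.
  elim: m => //= m <-; rewrite /d1 /d2; case: (T m); case: (e m) => /=; lia.
rewrite natrD => h.
rewrite -[2 ^+ m]ger0_norm ?exprn_ge0 // -normrM ler_norml.
have := bin_val_ge d1 m; have := bin_val_le d1 m.
have := bin_val_ge d2 m; have := bin_val_le d2 m.
have := bin_val_ge e m; have := bin_val_le e m; lra.
Qed.

(** * Hausdorff null sets *)

Lemma diam_ge0 (U : set R) (x : R) : U x -> (0 <= diam U)%E.
Proof.
by move=> Ux; apply: ereal_sup_ubound; exists x => //; exists x => //; rewrite subrr normr0.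
Qed.

Lemma diam_pow_ge0 (t : R) (U : set R) : (0 <= diam_pow t U)%E.
Proof.
rewrite /diam_pow; case: pselect => [//|U0] /=.
by case: (diam U) => [r| |] //; rewrite lee_fin powR_ge0.
Qed.

Lemma diam_pow0 (t : R) : diam_pow t set0 = 0%E.
Proof. by rewrite /diam_pow; case: pselect. Qed.

Lemma diam_le (U : set R) (r : R) :
  (forall x y, U x -> U y -> `|x - y| <= r) -> (diam U <= r%:E)%E.
Proof.
by move=> h; apply: ge_ereal_sup => _ [x Ux] [y Uy] <-; rewrite lee_fin; exact: h.
Qed.

Lemma diam_pow_le (t r : R) (U : set R) : 0 <= t -> 0 <= r ->
  (forall x y, U x -> U y -> `|x - y| <= r) -> (diam_pow t U <= (r `^ t)%:E)%E.
Proof.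
move=> t0 r0 h; rewrite /diam_pow; case: pselect => [U0|U0] /=.
  by rewrite lee_fin powR_ge0.
have [x Ux] : U !=set0 by apply/set0P/eqP.
have := diam_ge0 _ _ Ux; have := diam_le _ _ h.
case: (diam U) => [d| |] //; rewrite !lee_fin => dr d0.
by apply: ge0_ler_powR.
Qed.

(** A null condition through finite covers, under which a union is handled by concatenating lists.
    Past its end a list is padded by [set0], whose [diam_pow] is 0 for every exponent. *)
Definition fin_null (t : R) (A : set R) : Prop :=
  forall eps delta : R, 0 < eps -> 0 < delta -> exists l : seq (set R),
    [/\ A `<=` \bigcup_i nth set0 l i,
        forall i, (diam (nth set0 l i) <= delta%:E)%E &
        (\sum_(U <- l) diam_pow t U <= eps%:E)%E].

Lemma hausdorff_measure_fin_null (t : R) (A : set R) :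
  fin_null t A -> hausdorff_measure t A = 0%E.
Proof.
move=> nA; have h delta : 0 < delta -> hausdorff_content t delta A = 0%E.
  move=> delta0; apply/eqP; rewrite eq_le; apply/andP; split.
    apply/lee_addgt0Pr => eps eps0; rewrite add0e.
    have [l [lA ld ls]] := nA _ _ eps0 delta0.
    apply: (@le_trans _ _ (\sum_(i <oo) diam_pow t (nth set0 l i))%E).
      by apply: ereal_inf_lbound; exists (nth set0 l).
    rewrite (nneseries_split 0 (size l)); last by move=> *; exact: diam_pow_ge0.
    rewrite eseries0 ?adde0 ?add0n; first by rewrite -(big_nth set0 xpredT).
    by move=> i il _; rewrite nth_default ?diam_pow0.
  apply: le_ereal_inf_tmp => _ [U _ <-].
  apply: nneseries_ge0; move=> i _ _; exact: diam_pow_ge0.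
apply/eqP; rewrite eq_le; apply/andP; split.
  by apply: ge_ereal_sup => _ [delta /RltP d0 <-]; rewrite (h _ d0).
by rewrite -(h 1 ltr01); apply: ereal_sup_ubound; exists 1 => //=; apply/RltP.
Qed.

Lemma fin_nullU (t : R) (A B : set R) :
  fin_null t A -> fin_null t B -> fin_null t (A `|` B).
Proof.
move=> nA nB eps delta eps0 delta0.
have e2 : 0 < eps / 2 by rewrite divr_gt0.
have [l [lA ld ls]] := nA _ _ e2 delta0.
have [k [kA kd ks]] := nB _ _ e2 delta0.
exists (l ++ k); split.
- move=> x [/lA[i _ li]|/kA[i _ ki]].
    exists i => //; rewrite nth_cat; case: ltnP => // il.
    by move: li; rewrite nth_default.
  by exists (size l + i)%N => //; rewrite nth_cat ltnNge leq_addr /= addKn.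
- by move=> i; rewrite nth_cat; case: ifP.
- by rewrite big_cat /= [eps]splitr EFinD; apply: leeD.
Qed.

Lemma fin_nullS (t : R) (A B : set R) : A `<=` B -> fin_null t B -> fin_null t A.
Proof.
move=> AB nB eps delta e0 d0; have [l [lB ld ls]] := nB _ _ e0 d0.
by exists l; split => // x /AB /lB.
Qed.

(** A cover by [2 ^ k] pieces of diameter at most [2 ^- m] costs at most 2 to the power [k - t * m],
    so a large [M] makes both mesh and cost small. *)
Lemma fin_null_dyadic (t : R) (A : set R) : 0 <= t ->
  (forall M : R, exists (m k : nat) (K : R -> nat -> Prop),
     [/\ M <= m%:R, M <= t * m%:R - k%:R,
         forall x, A x -> exists2 i, (i < 2 ^ k)%N & K x i &
         forall x y i, K x i -> K y i -> `|x - y| * 2 ^+ m <= 1]) ->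
  fin_null t A.
Proof.
move=> t0 h eps delta e0 d0.
have small (r : R) : 0 < r -> exists n : nat, (2 ^+ n)^-1 <= r.
  move=> r0; exists (Num.bound r^-1); rewrite -[leRHS]invrK lef_pV2 ?posrE ?invr_gt0 ?exp2_gt0 //.
  exact/ltW/upper_nthrootP.
have [n1 hn1] := small _ e0; have [n2 hn2] := small _ d0.
have [m [k [K [hm hk hA hK]]]] := h (maxn n1 n2)%:R.
have rn (n : nat) : (n <= maxn n1 n2)%N -> (2 ^+ (maxn n1 n2))^-1 <= (2 ^+ n)^-1 :> R.
  by move=> le; rewrite lef_pV2 ?posrE ?exp2_gt0 // ler_weXn2l // ler1n.
have Kd i x y : K x i -> K y i -> `|x - y| <= (2 ^+ m)^-1.
  by move=> Kx Ky; rewrite -[leRHS]mul1r ler_pdivlMr ?exp2_gt0 //; exact: hK Kx Ky.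
exists [seq [set x | K x i] | i <- iota 0 (2 ^ k)]; split.
- move=> x /hA[i ik Ki]; exists i => //.
  by rewrite (nth_map 0%N) ?size_iota // nth_iota.
- move=> i; case: (ltnP i (2 ^ k)) => ik; last first.
    rewrite nth_default ?size_map ?size_iota //.
    by apply: diam_le => x y [].
  rewrite (nth_map 0%N) ?size_iota // nth_iota //.
  apply: diam_le => x y Kx Ky; apply: le_trans (Kd _ _ _ Kx Ky) _.
  apply: le_trans hn2; apply: le_trans (rn n2 (leq_maxr _ _)).
  by rewrite lef_pV2 ?posrE ?exp2_gt0 // ler_weXn2l ?ler1n // -(ler_nat R).
rewrite big_map.
apply: (@le_trans _ _ (\sum_(i <- iota 0 (2 ^ k)) (((2 ^+ m)^-1 `^ t)%:E : \bar R))%E).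
  apply: lee_sum => i _; apply: diam_pow_le => //; last exact: Kd.
rewrite sumEFin lee_fin big_const_seq count_predT size_iota iter_addr_0.
apply: le_trans hn1; apply: le_trans (rn n1 (leq_maxl _ _)).
rewrite -[leLHS]mulr_natl natrX -!powR_mulrn // -!powRN -powRrM -powRD; last by rewrite pnatr_eq0 implybT.
by rewrite ler_powR ?ler1n //; lra.
Qed.

(** * Causal digit transformations *)

(** Countable subadditivity of Lebesgue measure; every lower bound on Hausdorff measure below rests
    on it. *)
Lemma unit_interval_cover (T : realType) (v l : nat -> T) : (forall i, 0 <= l i) ->
  (forall y, 0 <= y < 1 -> exists i, `|y - v i| <= l i) ->
  (1 <= \sum_(i <oo) (2 * l i)%:E)%E.
Proof.
move=> l0 h; pose I i : set T := `[v i - l i, v i + l i]%classic.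
pose J : set T := `[0, 1[%classic.
have : (lebesgue_measure J <= \sum_(i <oo) lebesgue_measure (I i))%E.
  apply: measure_sigma_subadditive.
  - by move=> i; exact: measurable_itv.
  - exact: measurable_itv.
  - move=> y; rewrite /J /= in_itv /= => /h[i hi].
    by exists i => //; rewrite /I /= in_itv /=; move: hi; rewrite ler_norml; lra.
rewrite /J lebesgue_measure_itv /= lte_fin ltr01 oppr0 adde0 => /le_trans; apply.
apply: lee_nneseries => [i *|i *]; first exact: measure_ge0.
rewrite /I lebesgue_measure_itv /=; case: ifP => _; last by rewrite lee_fin mulr_ge0.
by rewrite -EFinB lee_fin; lra.
Qed.

Section Causal.
Variable F : pred nat.

(** The number of free positions below [n], hence of bits of [a] listed before position [n]. *)
Fixpoint rank (n : nat) : nat := if n is k.+1 then rank k + F k else 0.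

Lemma rank_mono (m n : nat) : (m <= n)%N -> (rank m <= rank n)%N.
Proof.
elim: n => [|n IH]; first by rewrite leqn0 => /eqP ->.
by rewrite leq_eqVlt => /orP[/eqP ->//|/IH h] /=; lia.
Qed.

Definition causal (D : (nat -> bool) -> nat -> bool) : Prop :=
  (forall a n, F n -> D a n = a (rank n)) /\
  (forall a b n, ~~ F n -> (forall i, (i < rank n)%N -> a i = b i) -> D a n = D b n).

Variable D : (nat -> bool) -> nat -> bool.
Hypothesis cD : causal D.

(* Lexicographic order is preserved, so distances between prefixes do not shrink. *)
Lemma causal_expand (a b : nat -> bool) (m : nat) :
  (prefix_num a (rank m) <= prefix_num b (rank m))%N ->
  (prefix_num b (rank m) + prefix_num (D a) m <=
   prefix_num (D b) m + prefix_num a (rank m))%N.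
Proof.
case: cD => cF cN.
elim: m => //= m IH; case: (boolP (F m)) => Fm.
  rewrite addn1 /= !cF //.
  case: (a _) (b _) => -[] /=; move: IH; lia.
rewrite addn0 leq_eqVlt => /orP[/eqP e|lt].
  rewrite (cN a b m Fm (prefix_num_inj _ _ _ e)) e.
  by have := IH; rewrite e leqnn => /(_ isT); lia.
(* The gap is at least one and doubles, which absorbs the unit that differing determined digits may
   cost. *)
have := IH (ltnW lt).
by case: (D a m) (D b m) => -[] /=; lia.
Qed.

Lemma causal_prefix (a b : nat -> bool) (m : nat) :
  prefix_num a (rank m) = prefix_num b (rank m) ->
  prefix_num (D a) m = prefix_num (D b) m.
Proof.
move=> e; have := @causal_expand a b m; have := @causal_expand b a m.
by rewrite e leqnn => /(_ isT) ? /(_ isT) ?; lia.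
Qed.

(** Truncations of the images differ by at most 2, hence so do those of [a] and [b] by
    [causal_expand]; rounding adds the third unit. *)
Lemma causal_dist (a b : nat -> bool) (m : nat) :
  `|bin_val (D a) - bin_val (D b)| * 2 ^+ m <= 1 ->
  `|bin_val a - bin_val b| * 2 ^+ rank m <= 3.
Proof.
wlog le : a b / (prefix_num a (rank m) <= prefix_num b (rank m))%N => [H|].
  by have [/H|/ltnW/H h] := leqP (prefix_num a (rank m)) (prefix_num b (rank m));
    [apply | rewrite distrC => /h; rewrite distrC].
have := causal_expand _ _ _ le.
rewrite -[2 ^+ m]ger0_norm ?exprn_ge0 // -[2 ^+ rank m]ger0_norm ?exprn_ge0 //.
rewrite -!normrM !ler_norml => e h.
have := bin_val_ge (D a) m; have := bin_val_le (D a) m.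
have := bin_val_ge (D b) m; have := bin_val_le (D b) m.
have := bin_val_ge a (rank m); have := bin_val_le a (rank m).
have := bin_val_ge b (rank m); have := bin_val_le b (rank m).
move: e h le; rewrite -!(ler_nat R) !natrD; lra.
Qed.

(** By [causal_prefix], the first [m] digits of an image are fixed by [rank m] bits, so [2 ^ rank m]
    dyadic pieces cover the image. *)
Lemma causal_fin_null (t : R) : 0 <= t ->
  (forall M : R, exists m : nat, M <= m%:R /\ M <= t * m%:R - (rank m)%:R) ->
  fin_null t [set bin_val (D a) | a in [set: nat -> bool]].
Proof.
move=> t0 h; apply: fin_null_dyadic => // M; have [m [h1 h2]] := h M.
exists m, (rank m), (fun x i => exists2 a, x = bin_val (D a) & prefix_num a (rank m) = i).
split=> //.
  by move=> _ [a _ <-]; exists (prefix_num a (rank m)); [exact: prefix_num_lt | exists a].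
move=> _ _ i [a -> ai] [b -> bi]; apply: bin_val_dist; apply: causal_prefix.
by rewrite ai bi.
Qed.

Lemma causal_holder (t c d : R) (a b : nat -> bool) : 0 <= t ->
  (forall m, t * m%:R - c <= (rank m)%:R) -> d <= 1 ->
  `|bin_val (D a) - bin_val (D b)| <= d ->
  `|bin_val a - bin_val b| <= 3 * 2 `^ (c + t) * d `^ t.
Proof.
move=> t0 hc d1 hd; set e := `|bin_val a - bin_val b|.
have two1 : 1 <= 2 :> R by rewrite ler1n.
have step m : d * 2 ^+ m <= 1 -> e <= 3 * 2 `^ (c - t * m%:R).
  move=> dm; have /causal_dist : `|bin_val (D a) - bin_val (D b)| * 2 ^+ m <= 1.
    by apply: le_trans dm; rewrite ler_pM2r ?exp2_gt0.
  rewrite -/e -ler_pdivlMr ?exp2_gt0 // => /le_trans; apply.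
  rewrite ler_pM2l // -powR_mulrn // -powRN ler_powR //.
  by have := hc m; lra.
have [d0|d0|d0] := ltgtP d 0.
- by have := le_trans (normr_ge0 _) hd; rewrite leNgt d0.
(* [n] is the dyadic scale of [d]: apply [step] there, and compare with [d] through the next
   scale. *)
- have [n /andP[n1 n2]] : exists n, (d * 2 ^+ n <= 1) && (1 < d * 2 ^+ n.+1).
    have ex : exists n, 1 < d * 2 ^+ n.
      exists (Num.bound d^-1); rewrite mulrC -ltr_pdivrMr // mul1r.
      exact: upper_nthrootP.
    case: (ex_minnP ex) => -[|n] hn hmin; first by move: hn; rewrite expr0 mulr1 ltNge d1.
    exists n; rewrite hn andbT leNgt; apply/negP => /hmin; lia.
  apply: le_trans (step n n1) _.
  have h : 2 `^ (- t * n.+1%:R) <= d `^ t.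
    rewrite mulrC mulrN -mulNr powRrM.
    apply: ge0_ler_powR; rewrite ?nnegrE ?powR_ge0 ?(ltW d0) //.
    by rewrite powRN powR_mulrn // -[leLHS]mul1r ltW // ltr_pdivrMr ?exp2_gt0.
  rewrite -mulrA ler_pM2l //.
  apply: (@le_trans _ _ (2 `^ (c + t) * 2 `^ (- t * n.+1%:R))).
    rewrite -powRD ?pnatr_eq0 ?implybT // ler_powR // -(natr1 n); lra.
  by rewrite ler_wpM2l ?powR_ge0.
(* At [d = 0] the factor [powR d t] is 1 if [t = 0] and 0 otherwise; in the latter case the two
   readings must coincide. *)
have [tz|tp] := eqVneq t 0.
  have := step 0%N; rewrite d0 mul0r ler01 tz => /(_ isT).
  by rewrite mul0r subr0 addr0 powRr0 mulr1.
have -> : e = 0; last by rewrite !mulr_ge0 ?powR_ge0.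
have tp' : 0 < t by rewrite lt0r tp t0.
apply/eqP; rewrite eq_le normr_ge0 andbT leNgt; apply/negP => e0.
pose n := Num.bound (e^-1 * (3 * 2 `^ c)).
pose m := Num.bound (n%:R / t).
have := step m; rewrite d0 mul0r ler01 => /(_ isT).
apply/negP; rewrite -ltNge powRB ?pnatr_eq0 ?implybT // mulrA.
rewrite ltr_pdivrMr ?powR_gt0 // -ltr_pdivrMl //.
apply: (@lt_le_trans _ _ (2 ^+ n)); first exact: upper_nthrootP.
rewrite -powR_mulrn // ler_powR //.
have : n%:R / t < m%:R by apply: archi_boundP; rewrite divr_ge0.
by rewrite ltr_pdivrMr // mulrC => /ltW.
Qed.

(** Mass distribution: by [causal_holder], a cover of [B] is read back as a cover of [0, 1[ by
    intervals of radius [C] times the [t]-th power of the diameters, so its cost is at least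
    [(2 * C)^-1]. *)
Lemma causal_measure_neq0 (t c : R) (B : set R) : 0 <= t ->
  (forall m, t * m%:R - c <= (rank m)%:R) ->
  (forall a, B (bin_val (D a))) -> hausdorff_measure t B <> 0%E.
Proof.
move=> t0 hc BD; pose C := 3 * 2 `^ (c + t) : R.
have C0 : 0 < C by rewrite mulr_gt0 ?powR_gt0.
suff : ((2 * C)^-1%:E <= hausdorff_measure t B)%E.
  move=> + h; rewrite h lee_fin leNgt invr_gt0; apply/negP/negPn.
  by rewrite mulr_gt0.
(* Mesh 1 ensures the hypothesis [d <= 1] of [causal_holder]. *)
apply: (@le_trans _ _ (hausdorff_content t 1 B)); last first.
  by apply: ereal_sup_ubound; exists 1 => //=; apply/RltP.
apply: le_ereal_inf_tmp => _ [U [UB Ud] <-].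
(* [p] is the centre and radius of an interval containing all readings from [U i]; a set missing the
   image of [D] gets radius 0. *)
have key i : exists p : R * R, [/\ 0 <= p.2,
    forall a, U i (bin_val (D a)) -> `|bin_val a - p.1| <= p.2 &
    ((2 * p.2)%:E <= (2 * C)%:E * diam_pow t (U i))%E].
  case: (pselect (exists a, U i (bin_val (D a)))) => [[a Ua]|no]; last first.
    exists (0, 0); split=> [//|a Ua|]; first by case: no; exists a.
    by rewrite mulr0 mule_ge0 ?diam_pow_ge0 // lee_fin mulr_ge0 // ltW.
  have dab b : U i (bin_val (D b)) ->
      ((`|bin_val (D b) - bin_val (D a)|)%:E <= diam (U i))%E.
    by move=> Ub; apply: ereal_sup_ubound; exists (bin_val (D b)) => //; exists (bin_val (D a)).
  rewrite /diam_pow; case: pselect => [Ui0|Ui0] /=; first by move: Ua; rewrite Ui0.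
  have := Ud i; have := diam_ge0 _ _ Ua; move: dab.
  case: (diam (U i)) => [d| |] //= dab; rewrite !lee_fin => d0 d1.
  exists (bin_val a, C * d `^ t) => /=; split.
  - by rewrite mulr_ge0 ?powR_ge0 // ltW.
  - by move=> b Ub; apply: causal_holder => //; rewrite -lee_fin; exact: dab.
  - by rewrite -EFinM mulrA.
have [p hp] := choice key.
have h1 : (1 <= \sum_(i <oo) (2 * (p i).2)%:E)%E.
  apply: (@unit_interval_cover _ (fun i => (p i).1)) => [i|y y01]; first by have [] := hp i.
  have [i _ Ui] := UB _ (BD (bin_digits y)).
  by exists i; have [_ + _] := hp i => /(_ _ Ui); rewrite bin_digitsK.
have h2 : (1 <= (2 * C)%:E * \sum_(i <oo) diam_pow t (U i))%E.
  apply: le_trans h1 _; rewrite -nneseriesZl; last by move=> *; exact: diam_pow_ge0.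
  apply: lee_nneseries => [i *|i *]; last by have [] := hp i.
  by have [p0 _ _] := hp i; rewrite lee_fin mulr_ge0.
by rewrite -[((2 * C)^-1)%:E]mule1 lee_pdivrMl ?mulr_gt0.
Qed.
End Causal.

(** * Two null sets whose sum is an interval *)

Definition mask_digits (T : pred nat) (e : nat -> bool) (n : nat) : bool := T n && e n.

(** Across a gap from [M] to [M * M] all digits vanish, so [2 ^ M] pieces of diameter [2 ^- (M * M)]
    suffice. *)
Lemma mask_fin_null (T : pred nat) (t : R) : 0 < t ->
  (forall K : nat, exists2 M : nat, (K <= M)%N &
     forall n, (M <= n < M * M)%N -> ~~ T n) ->
  fin_null t [set bin_val (mask_digits T e) | e in [set: nat -> bool]].
Proof.
move=> t0 h; apply: fin_null_dyadic => [|M0]; first exact: ltW.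
(* The bound [2 / t] gives [t * M >= 2], hence [t * (M * M) - M >= M >= M0]. *)
have [M KM hM] := h (maxn 1 (maxn (Num.bound `|M0|) (Num.bound (2 / t)))).
move: KM; rewrite !geq_max => /and3P[M1 M2 M3].
have {}M2 : M0 <= M%:R.
  apply: le_trans (ler_norm _) _; apply: le_trans (ltW (archi_boundP (normr_ge0 _))) _.
  by rewrite ler_nat.
have {}M3 : 2 <= t * M%:R.
  rewrite -ler_pdivrMl // mulrC.
  apply: le_trans (ltW (archi_boundP _)) _; first by rewrite divr_ge0 // ltW.
  by rewrite ler_nat.
have M1' : 1 <= M%:R :> R by rewrite ler1n.
exists (M * M)%N, M, (fun x i => exists2 e, x = bin_val (mask_digits T e) & prefix_num (mask_digits T e) M = i).
split.
- by apply: le_trans M2 _; rewrite natrM; nra.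
- by apply: le_trans M2 _; rewrite natrM; nra.
- by move=> _ [e _ <-]; exists (prefix_num (mask_digits T e) M); [exact: prefix_num_lt | exists e].
- move=> _ _ i [e -> ei] [f -> fi]; apply: bin_val_dist.
  have MM : (M <= M * M)%N by rewrite leq_pmull.
  rewrite -(subnKC MM) !prefix_num_zeros ?ei ?fi // => k kM;
    by rewrite /mask_digits (negPf (hM _ _)) //; lia.
Qed.

(** Constant on each block from [M] to [M * M] with [M = 2 ^ 2 ^ k]; its parity deals these blocks
    alternately to two sets of positions. *)
Definition loglog (n : nat) : nat := trunc_log 2 (trunc_log 2 n).

Lemma loglog_eq (k n : nat) : (2 ^ 2 ^ k <= n < 2 ^ 2 ^ k * 2 ^ 2 ^ k)%N -> loglog n = k.
Proof.
rewrite -expnD addnn -mul2n -expnS => /andP[n1 n2].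
have n0 : (0 < n)%N by apply: leq_trans n1; rewrite expn_gt0.
have /andP[l1 l2] := trunc_log_bounds (ltnSn 1) n0.
apply: trunc_log_eq => //.
have := leq_ltn_trans n1 l2; have := leq_ltn_trans l1 n2.
by rewrite !ltn_exp2l // => -> ; rewrite ltnS => ->.
Qed.

Lemma loglog_gaps (b : bool) (K : nat) : exists2 M : nat, (K <= M)%N &
  forall n, (M <= n < M * M)%N -> ~~ (odd (loglog n) == b).
Proof.
pose k := (K.*2 + ~~ b)%N; exists (2 ^ 2 ^ k)%N.
  apply: leq_trans (ltnW (ltn_expl _ (ltnSn 1))); apply: leq_trans (ltnW (ltn_expl _ (ltnSn 1))).
  by rewrite /k; lia.
by move=> n /loglog_eq ->; rewrite /k oddD odd_double; case: (b).
Qed.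

(** * Hamel bases between an independent set and a spanning set *)

(** Vectors may repeat in the list, so sums are concatenations; [Q_spansP] merges repeated vectors
    afterwards. *)
Definition in_span (B : set R) (y : R) : Prop :=
  exists2 l : seq (rat * R), (forall p, p \in l -> B p.2) &
    y = \sum_(p <- l) ratr p.1 * p.2.

Lemma in_span_mem (B : set R) (x : R) : B x -> in_span B x.
Proof.
move=> Bx; exists [:: (1, x)]; first by move=> p; rewrite inE => /eqP ->.
by rewrite big_seq1 rmorph1 mul1r.
Qed.

Lemma in_spanD (B : set R) (x y : R) : in_span B x -> in_span B y -> in_span B (x + y).
Proof.
move=> [l lB ->] [k kB ->]; exists (l ++ k); last by rewrite big_cat.
by move=> p; rewrite mem_cat => /orP[/lB|/kB].
Qed.

Lemma in_spanZ (B : set R) (q : rat) (x : R) : in_span B x -> in_span B (ratr q * x).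
Proof.
move=> [l lB ->]; exists [seq (q * p.1, p.2) | p <- l].
  by move=> _ /mapP[p /lB Bp ->].
by rewrite big_map mulr_sumr; apply: eq_bigr => p _ /=; rewrite rmorphM mulrA.
Qed.

Lemma in_span_sum (B : set R) (s : seq R) (c : R -> rat) :
  (forall x, x \in s -> in_span B x) -> in_span B (\sum_(x <- s) ratr (c x) * x).
Proof.
elim: s => [|x s IH] h; first by rewrite big_nil; exists [::]; rewrite ?big_nil.
rewrite big_cons; apply: in_spanD; first by apply/in_spanZ/h/mem_head.
by apply: IH => y ys; apply: h; rewrite inE ys orbT.
Qed.

Lemma Q_spansP (B : set R) : (forall y, in_span B y) -> Q_spans B.
Proof.
move=> h y; have [l lB ->] := h y.
exists (undup [seq p.2 | p <- l]), (fun x => \sum_(p <- l | p.2 == x) p.1); split.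
  by move=> x; rewrite mem_undup => /mapP[p /lB Bp ->].
under [RHS]eq_bigr do rewrite rmorph_sum mulr_suml.
rewrite (exchange_big_dep xpredT) //= big_seq [RHS]big_seq; apply: eq_bigr => p pl.
rewrite big_mkcond (bigD1_seq p.2) ?undup_uniq ?mem_undup ?map_f //= eqxx.
by rewrite big1 ?addr0 // => x xp; rewrite eq_sym (negPf xp).
Qed.

Lemma Q_lin_indepU1 (B : set R) (g : R) :
  Q_lin_indep B -> ~ in_span B g -> Q_lin_indep (B `|` [set g]).
Proof.
move=> iB ng s c us sB s0.
have Bs x : x \in s -> x != g -> B x by move=> /sB[//|->]; rewrite eqxx.
case: (boolP (g \in s)) => [gs|gs]; last first.
  by apply: iB us _ s0 => x xs; apply: Bs => //; apply: contraNneq gs => <-.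
move: s0; rewrite (bigD1_seq g) //= -big_filter.
set r := [seq x <- s | x != g] => s0.
have rB x : x \in r -> B x by rewrite mem_filter => /andP[xg xs]; exact: Bs.
have cg : c g = 0.
  apply/eqP/negPn/negP => cg; apply: ng.
  have cg' : ratr (c g) != 0 :> R by rewrite fmorph_eq0.
  have -> : g = ratr (- (c g)^-1) * \sum_(x <- r) ratr (c x) * x.
    move/eqP: s0; rewrite addrC addr_eq0 => /eqP ->.
    by rewrite rmorphN fmorphV mulrNN mulKf.
  by apply/in_spanZ/in_span_sum => x /rB /in_span_mem.
move: s0; rewrite cg rmorph0 mul0r add0r => s0 x xs.
have [-> //|xg] := eqVneq x g.
by apply: (iB r) => //; [exact: filter_uniq | rewrite mem_filter xg].
Qed.

Lemma hamel_basis_between (B0 G : set R) : Q_lin_indep B0 -> B0 `<=` G ->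
  Q_spans G -> exists B, [/\ B0 `<=` B, B `<=` G & hamel_basis B].
Proof.
move=> i0 B0G sG.
(* Adjoining [B0] inside the condition, instead of asking [A] to contain it, lets the empty chain
   have an admissible union. *)
pose P : set (set R) := fun A => Q_lin_indep (A `|` B0) /\ A `<=` G.
have [F FP tF|A [[iA AG] maxA]] := @Zorn_bigcup _ P.
  split; last by move=> x [A /FP[_ AG] /AG].
  move=> s c us sB s0; case: (pselect (exists A, F A)) => [[A0 FA0]|no]; last first.
    apply: i0 us _ s0 => x /sB[[A FA _]|//]; by case: no; exists A.
  (* A finite list drawn from the union of a chain already lies in a single member together with
     [B0]. *)
  suff [A FA sA] : exists2 A, F A & forall x, x \in s -> (A `|` B0) x.
    by have [iA _] := FP _ FA; exact: iA us sA s0.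
  elim: s sB {us s0} => [_|x s IH sB]; first by exists A0.
  have [y ys|A FA sA] := IH; first by apply: sB; rewrite inE ys orbT.
  have [[A' FA' A'x]|B0x] := sB x (mem_head _ _); last first.
    by exists A => // y; rewrite inE => /orP[/eqP ->|/sA //]; right.
  case: (tF _ _ FA FA') => AA.
    exists A' => // y; rewrite inE => /orP[/eqP ->|/sA[/AA|]]; by [left|right|left].
  exists A => // y; rewrite inE => /orP[/eqP ->|/sA //]; by left; exact: AA.
exists (A `|` B0); split; [by move=> x; right | by move=> x [/AG|/B0G] |].
split=> //; apply: Q_spansP => y.
have [s [c [sG' ->]]] := sG y; apply: in_span_sum => g /sG' Gg.
apply: contrapT => ng; apply: (maxA (A `|` [set g])).
  split; first by move=> x; left.
  by move=> AgA; apply/ng/in_span_mem; left; apply: AgA; right.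
split; last by move=> x [/AG //|->].
by rewrite -setUA [_ `|` B0]setUC setUA; exact: Q_lin_indepU1.
Qed.

(** * An independent set of prescribed dimension *)

(** The Sturmian word of slope [s]: for [s] at most 1 the floor of [n * s] jumps by at most one, so
    the jumps mark positions of density exactly [s]. *)
Definition beatty (s : R) (n : nat) : bool :=
  (Num.truncn (n%:R * s) < Num.truncn (n.+1%:R * s))%N.

Lemma rank_beatty (s : R) (n : nat) : 0 <= s -> s <= 1 ->
  rank (beatty s) n = Num.truncn (n%:R * s).
Proof.
move=> s0 s1; elim: n => [|n /= ->]; first by rewrite mul0r truncn0.
rewrite /beatty.
have le : (Num.truncn (n%:R * s) <= Num.truncn (n.+1%:R * s))%N.
  by apply: le_truncn; rewrite ler_wpM2r // ler_nat.
have : (Num.truncn (n.+1%:R * s) <= (Num.truncn (n%:R * s)).+1)%N.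
  have n0 : 0 <= n%:R * s by rewrite mulr_ge0.
  rewrite -ltnS truncn_lt_nat ?mulr_ge0 //.
  have /andP[_] := truncn_itv n0.
  rewrite -(natr1 n) -[in X in _ -> X]natr1; lra.
by move=> le'; move: le; rewrite leq_eqVlt => /orP[/eqP <-|lt]; rewrite ?ltnn ?lt; lia.
Qed.

Definition tag_block (n : nat) : bool := (n - 2 ^ trunc_log 2 n <= (trunc_log 2 n).*2)%N.

Lemma rank_tag_block (n : nat) : (rank tag_block n <= (trunc_log 2 n).+1 ^ 2 + 1)%N.
Proof.
case: n => // n.
(* The summands account for position 0, the complete blocks of lengths [2 * i + 1], and the part
   reached of the current block. *)
suff : (rank tag_block n.+1 <=
    1 + trunc_log 2 n.+1 ^ 2 + minn (n.+1 - 2 ^ trunc_log 2 n.+1) (trunc_log 2 n.+1).*2.+1)%N by lia.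
elim: n => // n; rewrite [rank tag_block n.+2]/=.
rewrite -[(rank tag_block n + _)%N]/(rank tag_block n.+1).
have /andP[a1 a2] := trunc_log_bounds (ltnSn 1) (ltn0Sn n).
set l := trunc_log 2 n.+1 in a1 a2 *.
have -> : tag_block n.+1 = (n.+1 - 2 ^ l <= l.*2)%N by [].
have [b|b] := ltnP n.+2 (2 ^ l.+1)%N.
  rewrite (@trunc_log_eq 2 l n.+2) //; last by rewrite b andbT (leq_trans a1).
  by case: leqP; lia.
have e : n.+2 = (2 ^ l.+1)%N by lia.
rewrite (@trunc_log_eq 2 l.+1 n.+2) //; last first.
  by rewrite e leqnn ltn_exp2l // ltnSn.
by rewrite e subnn; case: leqP; lia.
Qed.

Lemma square_le_exp2 (N : nat) : exists c : nat, forall l, (N * l.+1 ^ 2 <= 2 ^ l + c)%N.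
Proof.
have cube l : (11 <= l -> l.+1 ^ 3 <= 2 ^ l)%N.
  elim: l => // l IH; rewrite leq_eqVlt => /orP[/eqP <- //|].
  rewrite ltnS => l11; have := IH l11; rewrite [(2 ^ l.+1)%N]expnS.
  have : (l.+2 ^ 3 <= 2 * l.+1 ^ 3)%N by rewrite !expnS expn0; nia.
  lia.
exists (N * (N + 12) ^ 2)%N => l; have [h|h] := leqP (N + 11) l.
  apply: leq_trans (leq_addr _ _); apply: leq_trans (cube l _); last by lia.
  by rewrite [(_ ^ 3)%N]expnS leq_mul2r; apply/orP; right; lia.
apply: leq_trans (leq_addl _ _); rewrite leq_mul2l leq_sqr; apply/orP; right; lia.
Qed.

Definition free_pos (s : R) (n : nat) : bool := ~~ tag_block n && beatty s n.

Lemma rank_free_le (s : R) (n : nat) : 0 <= s -> s <= 1 ->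
  (rank (free_pos s) n)%:R <= n%:R * s.
Proof.
move=> s0 s1; apply: (@le_trans _ _ (Num.truncn (n%:R * s))%:R); last first.
  by rewrite truncn_le mulr_ge0.
rewrite -rank_beatty // ler_nat.
elim: n => //= n IH.
have : (free_pos s n <= beatty s n)%N by rewrite /free_pos; case: (tag_block n).
lia.
Qed.

(** Tags take only about the squared logarithm of [n] positions, less than the linear slack
    [(s - t) * n] up to a constant. *)
Lemma rank_free_ge (s t : R) : 0 <= s -> s <= 1 -> t < s ->
  exists c : R, forall n, t * n%:R - c <= (rank (free_pos s) n)%:R.
Proof.
move=> s0 s1 ts; have st : 0 < s - t by rewrite subr_gt0.
pose N := (Num.bound (s - t)^-1).+1; have [c hc] := square_le_exp2 N.
exists ((s - t) * (1 + c%:R) + 2) => n.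
have h1 : (rank (beatty s) n <= rank (free_pos s) n + rank tag_block n)%N.
  elim: n => //= n IH.
  have : (beatty s n <= free_pos s n + tag_block n)%N.
    by rewrite /free_pos; case: (tag_block n); case: (beatty s n).
  lia.
have h2 := rank_tag_block n; set l := trunc_log 2 n in h2.
have h3 : (N * l.+1 ^ 2 <= n + 1 + c)%N.
  apply: leq_trans (hc l) _; rewrite leq_add2r /l.
  by case: (n) => // k; apply: leq_trans (trunc_logP _ _) _; rewrite ?leq_addr.
have h4 : (l.+1 ^ 2)%N%:R <= (s - t) * (n%:R + 1 + c%:R) :> R.
  have : 1 <= (s - t) * N%:R.
    rewrite -ler_pdivrMl // mulr1 /N ltW //.
    apply: lt_le_trans (archi_boundP _) _; first by rewrite invr_ge0 ltW.
    by rewrite ler_nat.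
  move: h3; rewrite -(ler_nat R) !natrD natrM.
  have : 0 <= (l.+1 ^ 2)%N%:R :> R by rewrite ler0n.
  move: (_%:R) => X; nra.
have h5 : n%:R * s < (Num.truncn (n%:R * s))%:R + 1.
  by have /andP[_] := truncn_itv (mulr_ge0 (ler0n R n) s0); rewrite -natr1.
rewrite -rank_beatty // in h5.
move: h1 h2; rewrite -!(ler_nat R) !natrD; lra.
Qed.

Lemma rank_free_unbounded (s : R) (L : nat) : 0 < s -> s <= 1 ->
  exists m, (L <= rank (free_pos s) m)%N.
Proof.
move=> s0 s1.
have [|c hc] := @rank_free_ge s (s / 2) (ltW s0) s1; first by lra.
exists (Num.bound (`|L%:R + c| * (s / 2)^-1)); rewrite -(ler_nat R).
set m := Num.bound _; apply: le_trans (hc m).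
have : `|L%:R + c| * (s / 2)^-1 < m%:R.
  by apply: archi_boundP; rewrite mulr_ge0 // invr_ge0 divr_ge0 // ltW.
rewrite ltr_pdivrMr ?divr_gt0 // => /ltW /(le_trans (ler_norm _)); lra.
Qed.

(* Every word occurs as a tag at infinitely many stages, because the second
   component of the code is unused. *)
Definition tag_word (j : nat) : seq bool :=
  if unpickle j is Some p then (p : seq bool * nat).1 else [::].

Lemma tag_word_often (w : seq bool) (J : nat) : exists2 j, (J <= j)%N & tag_word j = w.
Proof.
case: (pselect (exists e : nat, (J <= pickle (w, e))%N)) => [[e he]|no].
  by exists (pickle (w, e)) => //; rewrite /tag_word pickleK.
have lt (e : nat) : (pickle (w, e) < J)%N.
  by rewrite ltnNge; apply/negP => h; apply: no; exists e.
pose f (e : 'I_J.+1) : 'I_J := Ordinal (lt e).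
have /leq_card : injective f.
  by move=> e1 e2 /(congr1 val) /= /(pcan_inj pickleK) [/val_inj].
by rewrite !card_ord ltnn.
Qed.

(* The block starting at [2 ^ j] carries a single digit, in its middle; it is [1]
   exactly when the word [tag_word j] is a prefix of [a]. *)
Definition tagged_digits (s : R) (a : nat -> bool) (n : nat) : bool :=
  if free_pos s n then a (rank (free_pos s) n) else
  let j := trunc_log 2 n in let w := tag_word j in
  [&& n == (2 ^ j + j)%N, (size w <= rank (free_pos s) (2 ^ j))%N & mkseq a (size w) == w].

(** The length test in [tagged_digits] secures this: a tag inspects only bits listed before its
    block starts. *)
Lemma tagged_digits_causal (s : R) : causal (free_pos s) (tagged_digits s).
Proof.
split=> [a n fn|a b n fn ab]; first by rewrite /tagged_digits fn.
rewrite /tagged_digits (negPf fn) /=; set j := trunc_log 2 n.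
case: eqP => //= nj; case: leqP => //= le; congr (_ == _).
apply/eq_in_map => i; rewrite mem_iota add0n => iw; apply: ab.
apply: leq_trans iw _; apply: leq_trans le _; apply: rank_mono; lia.
Qed.

Lemma tagged_digits_block (s : R) (a : nat -> bool) (j i : nat) :
  (3 <= j)%N -> (i <= j.*2)%N ->
  tagged_digits s a (2 ^ j + i) =
  [&& i == j, (size (tag_word j) <= rank (free_pos s) (2 ^ j))%N &
      mkseq a (size (tag_word j)) == tag_word j].
Proof.
move=> j3 ij.
have j2 : (j.*2 < 2 ^ j)%N.
  elim: j j3 {ij} => // j IH; rewrite leq_eqVlt => /orP[/eqP <- //|].
  by rewrite ltnS => j3; have := IH j3; rewrite expnS; lia.
have lj : trunc_log 2 (2 ^ j + i) = j.
  by apply: trunc_log_eq => //; rewrite expnS; lia.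
have fj : free_pos s (2 ^ j + i) = false by rewrite /free_pos /tag_block lj addKn ij.
by rewrite /tagged_digits fj lj eqn_add2l.
Qed.

(** If the sum vanished, the remainders [th x] would combine to an integer of absolute value below
    1, hence to 0. But the term of [x0] is at least [2 ^- j.+1], and the others together stay below
    that. *)
Lemma int_combination_neq0 (l : seq R) (x0 : R) (c : R -> int) (p : R -> nat) (m j : nat) :
  uniq l -> x0 \in l -> c x0 != 0 ->
  \sum_(x <- l) `|(c x)%:~R| < 2 ^+ j :> R ->
  (forall x, x \in l -> x != x0 -> 0 <= x * 2 ^+ m - (p x)%:R <= (2 ^+ j.*2.+1)^-1) ->
  (2 ^+ j.+1)^-1 <= x0 * 2 ^+ m - (p x0)%:R <= (2 ^+ j)^-1 ->
  \sum_(x <- l) (c x)%:~R * x != 0.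
Proof.
move=> ul xl c0 hC hl hx0; apply/negP => /eqP sum0.
pose th x := x * 2 ^+ m - (p x)%:R; pose C := \sum_(x <- l) `|(c x)%:~R| : R.
have pj n : 0 < (2 ^+ n)^-1 :> R by rewrite invr_gt0 exp2_gt0.
have /andP[hx1 hx2] := hx0.
have thj x : x \in l -> `|th x| <= (2 ^+ j)^-1.
  move=> xl'; have [->|ne] := eqVneq x x0.
    by rewrite ger0_norm // (le_trans _ hx1) // ltW.
  have /andP[t0 t1] := hl _ xl' ne; rewrite ger0_norm //; apply: le_trans t1 _.
  by rewrite lef_pV2 ?posrE ?exp2_gt0 // ler_weXn2l ?ler1n //; lia.
have sumth : \sum_(x <- l) (c x)%:~R * th x = (- \sum_(x <- l) c x * (p x)%:Z)%:~R.
  rewrite rmorphN rmorph_sum /=.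
  transitivity (\sum_(x <- l) ((c x)%:~R * x * 2 ^+ m - (c x * (p x)%:Z)%:~R)).
    by apply: eq_bigr => x _; rewrite intrM /th mulrBr mulrA.
  by rewrite sumrB -mulr_suml sum0 mul0r add0r.
have small (r : seq R) (P : pred R) (e : R) : (forall x, x \in r -> P x -> `|th x| <= e) ->
    `|\sum_(x <- r | P x) (c x)%:~R * th x| <= (\sum_(x <- r | P x) `|(c x)%:~R|) * e.
  move=> h; apply: le_trans (ler_norm_sum _ _ _) _.
  rewrite mulr_suml big_seq_cond [leRHS]big_seq_cond; apply: ler_sum => x /andP[xr Px].
  by rewrite normrM ler_wpM2l //; apply: h.
have z0 : \sum_(x <- l) (c x)%:~R * th x = 0.
  have : `|\sum_(x <- l) (c x)%:~R * th x| < 1.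
    apply: le_lt_trans (small l xpredT _ (fun x xl _ => thj x xl)) _.
    by rewrite ltr_pdivrMr ?exp2_gt0 // mul1r.
  rewrite sumth -intr_norm -[1]/(1%:~R) ltr_int => h.
  by have -> : - \sum_(x <- l) c x * (p x)%:Z = 0; [lia | rewrite rmorph0].
have : `|(c x0)%:~R * th x0| <= C * (2 ^+ j.*2.+1)^-1.
  move/eqP: z0; rewrite (bigD1_seq x0) //= addr_eq0 => /eqP ->; rewrite normrN.
  apply: le_trans (small _ _ (2 ^+ j.*2.+1)^-1 _) _.
    by move=> x xl' /(hl _ xl')/andP[t0 t1]; rewrite ger0_norm.
  apply: ler_wpM2r; first exact/ltW/pj.
  by rewrite /C (bigD1_seq x0) //= lerDr.
apply/negP; rewrite -ltNge.
apply: (@lt_le_trans _ _ (2 ^+ j.+1)^-1).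
  have -> : (2 ^+ j.+1)^-1 = 2 ^+ j * (2 ^+ j.*2.+1)^-1 :> R.
    rewrite (_ : j.*2.+1 = j + j.+1)%N; last by lia.
    by rewrite exprD invfM mulrA divff ?mul1r // gt_eqF ?exp2_gt0.
  by rewrite ltr_pM2r.
rewrite normrM -[leLHS]mul1r; apply: ler_pM => //.
  by rewrite -intr_norm -[1]/(1%:~R) ler_int; lia.
by apply: le_trans hx1 _; exact: ler_norm.
Qed.

Lemma clear_denominators (l : seq R) (c : R -> rat) :
  exists2 N : nat, (0 < N)%N & forall x, x \in l -> c x * N%:R = (numq (c x * N%:R))%:~R.
Proof.
suff [N N0 h] : exists2 N : nat, (0 < N)%N & forall x, x \in l ->
    exists z : int, c x * N%:R = z%:~R.
  by exists N => // x /h[z ->]; rewrite numq_int.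
elim: l => [|x l [N N0 IH]]; first by exists 1%N.
exists (`|denq (c x)| * N)%N; first by rewrite muln_gt0 N0 absz_gt0 denq_neq0.
have e : `|denq (c x)|%N%:R = (denq (c x))%:~R :> rat by rewrite pmulrn absz_denq.
move=> y; rewrite inE natrM e => /orP[/eqP ->|/IH[z hz]].
  by exists (numq (c x) * N%:Z); rewrite mulrA -numqE intrM.
by exists (denq (c x) * z); rewrite mulrCA hz intrM.
Qed.

Lemma separating_length (l : seq (nat -> bool)) (a : nat -> bool) :
  exists L : nat, forall b : nat -> bool, List.In b l -> b <> a -> mkseq b L != mkseq a L.
Proof.
elim: l => [|b l [L IH]]; first by exists 0%N.
have [i hi] : exists i : nat, b <> a -> b i != a i.
  case: (pselect (b = a)) => [e|ne]; first by exists 0%N.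
  have [i hi] : exists i, b i <> a i by apply/existsNP => h; apply: ne; apply/funext.
  by exists i => _; apply/eqP.
exists (maxn L i.+1) => d [<- ba|dl da].
  apply/eqP => /(congr1 (fun w => nth false w i)).
  by rewrite !nth_mkseq ?leq_maxr //; apply/eqP/hi.
apply: contraNneq (IH _ dl da) => /(congr1 (take L)).
by rewrite /mkseq -!map_take take_iota (minn_idPl (leq_maxl _ _)) => ->.
Qed.

Lemma tagged_digits_indep (s : R) : 0 < s -> s <= 1 ->
  Q_lin_indep [set bin_val (tagged_digits s a) | a in [set: nat -> bool]].
Proof.
move=> s0 s1 l c ul lB sum0 x0 xl; apply/eqP/negPn/negP => c0.
have /choice[a ha] : forall x, exists b, x \in l -> bin_val (tagged_digits s b) = x.
  move=> x; case: (boolP (x \in l)) => [/lB[b _ bx]|_]; first by exists b.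
  by exists xpred0.
have [N N0 hN] := clear_denominators l c.
pose cz x := numq (c x * N%:R).
have [L hL] := separating_length [seq a x | x <- l] (a x0).
pose w := mkseq (a x0) L; have sw : size w = L by rewrite size_mkseq.
have [m0 hm0] := rank_free_unbounded s L s0 s1.
pose C : R := \sum_(x <- l) `|(cz x)%:~R|.
(* The summand 3 makes the block fit, [m0] makes [L] bits available before it, and the last one
   gives [C < 2 ^+ j]. *)
have [j Jj jw] := tag_word_often w (3 + m0 + Num.bound C).
pose D := tagged_digits s.
have Lj : (L <= rank (free_pos s) (2 ^ j))%N.
  apply: leq_trans hm0 _; apply: rank_mono.
  by apply: leq_trans (ltnW (ltn_expl _ (ltnSn 1))); lia.
have j3 : (3 <= j)%N by lia.
have zero x i : (i < j)%N -> D (a x) (2 ^ j + i)%N = false.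
  by move=> ij; rewrite /D tagged_digits_block //; [rewrite ltn_eqF | lia].
have : \sum_(x <- l) (cz x)%:~R * x != 0 :> R.
  apply: (@int_combination_neq0 l x0 cz (fun x => prefix_num (D (a x)) (2 ^ j)) (2 ^ j) j) => //.
  - by rewrite numq_eq0 mulf_neq0 // pnatr_eq0 -lt0n.
  - exact: upper_nthrootP (leq_trans (leq_addl _ _) Jj).
  (* [w] is not a prefix of [a x], so the whole block is zero. *)
  - move=> x xl' xx0; rewrite -{1 3}(ha x xl').
    have bx : a x <> a x0 by move=> e; case/eqP: xx0; rewrite -(ha _ xl') e ha.
    have zx i : (i < j.*2.+1)%N -> D (a x) (2 ^ j + i)%N = false.
      move=> ij; rewrite /D tagged_digits_block // jw sw.
      rewrite (negPf (hL (a x) _ bx)) ?andbF //.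
      by elim: (l) xl' => //= y r IH; rewrite inE => /orP[/eqP ->|/IH]; [left|right].
    have := bin_val_ge (D (a x)) (2 ^ j); have := bin_val_le (D (a x)) (2 ^ j + j.*2.+1).
    rewrite (prefix_num_zeros _ _ _ zx) natrM natrX exprD.
    rewrite mulrA -lerBlDl -mulrBl -ler_pdivlMr ?exp2_gt0 // mul1r => h1 h2.
    by rewrite h1 subr_ge0 h2.
  (* Here the block shows [j] zeros followed by the tag digit 1. *)
  - rewrite -{1 3}(ha x0 xl).
    have := bin_val_ge (D (a x0)) (2 ^ j + j.+1); have := bin_val_le (D (a x0)) (2 ^ j + j).
    rewrite addnS /= (prefix_num_zeros _ _ _ (zero x0)).
    rewrite /D tagged_digits_block //; last by lia.
    rewrite jw sw eqxx Lj eqxx /= -muln2 natrD !natrM !natrX exprSr exprD.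
    rewrite mulrA -lerBlDl -mulrBl -ler_pdivlMr ?exp2_gt0 // mul1r => h1 h2.
    rewrite h1 andbT -[leLHS]mul1r ler_pdivrMr ?exp2_gt0 // exprSr; lra.
case/eqP; move/(congr1 (fun y => y * N%:R)): sum0; rewrite mul0r mulr_suml => sum0.
rewrite -[RHS]sum0 big_seq [RHS]big_seq; apply: eq_bigr => x xl'.
rewrite mulrAC; congr (_ * _).
by rewrite -(ratr_nat R N) -rmorphM /= (hN x xl') ratr_int.
Qed.

(** * Dimension of a basis between the independent set and its null extension *)

Theorem theorem3p1 :
  CH ->
  forall s : R, 0 < s -> s <= 1 ->
  exists B : set R, hamel_basis B /\ hausdorff_dim B = s%:E.
Proof.
move=> _ s s0 s1.
pose B0 := [set bin_val (tagged_digits s a) | a in [set: nat -> bool]].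
pose Z b := [set bin_val (mask_digits (fun n => odd (loglog n) == b) e) | e in [set: nat -> bool]].
pose G := B0 `|` (Z true `|` Z false).
have [||B [B0B BG hB]] := @hamel_basis_between B0 G (tagged_digits_indep s s0 s1).
- by move=> x; left.
- apply: Q_spansP => y.
  (* Scaling by an integer and a sign reduces spanning to [0, 1[, where splitting the digits writes
     [z] as a sum from the two null sets. *)
  pose N := (Num.bound `|y|).+1; pose z := `|y| / N%:R.
  have N0 : 0 < N%:R :> R by rewrite ltr0n.
  have z01 : 0 <= z < 1.
    rewrite divr_ge0 //= ltr_pdivrMr // mul1r (lt_le_trans (archi_boundP _)) //.
    by rewrite ler_nat.
  have zG : in_span G z.
    rewrite -(bin_digitsK z z01) -(bin_val_split (fun n => odd (loglog n))).
    apply: in_spanD; apply: in_span_mem; right; [left|right]; exists (bin_digits z) => //;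
      by congr bin_val; apply/funext => n; rewrite /mask_digits; case: (odd _).
  pose b : bool := y < 0.
  have -> : y = ratr ((-1) ^+ b * N%:R) * z.
    rewrite rmorphM /= ratr_nat rmorph_sign -mulrA [N%:R * _]mulrC divfK ?gt_eqF //.
    by rewrite -realEsign // num_real.
  exact: in_spanZ.
exists B; split=> //.
have null t : s < t -> hausdorff_measure t B = 0%E.
  move=> st; have t0 : 0 < t by exact: lt_trans st.
  apply: hausdorff_measure_fin_null; apply: fin_nullS BG _.
  apply: fin_nullU; last by apply: fin_nullU; apply: mask_fin_null => // K; exact: loglog_gaps.
  apply: (causal_fin_null _ _ (tagged_digits_causal s) t (ltW t0)) => M.
  have st' : 0 < t - s by rewrite subr_gt0.
  (* The second bound gives [(t - s) * m >= M], which suffices since [rank] is at most [s * m]. *)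
  exists (maxn (Num.bound `|M|) (Num.bound (`|M| / (t - s)))); set m := maxn _ _.
  have m1 : `|M| <= m%:R.
    by apply: le_trans (ltW (archi_boundP _)) _; rewrite // ler_nat leq_maxl.
  have m2 : `|M| <= (t - s) * m%:R.
    rewrite -ler_pdivrMl // mulrC.
    apply: le_trans (ltW (archi_boundP _)) _; first by rewrite divr_ge0 // ltW.
    by rewrite ler_nat leq_maxr.
  split; first exact: le_trans (ler_norm _) m1.
  apply: le_trans (ler_norm _) _; apply: le_trans m2 _.
  have := rank_free_le s m (ltW s0) s1; lra.
apply/eqP; rewrite eq_le; apply/andP; split.
  apply/lee_addgt0Pr => e e0; rewrite -EFinD; apply: ereal_inf_lbound.
  exists (s + e) => //; split; last by apply: null; rewrite ltrDl.
  by apply/RleP; rewrite addr_ge0 // ltW.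
apply: le_ereal_inf_tmp => _ [t [/RleP t0 ht] <-]; rewrite lee_fin leNgt; apply/negP => ts.
(* An exponent below [s] is excluded because [B] contains the image [B0], whose measure at that
   exponent is bounded away from 0. *)
have [c hc] := rank_free_ge s t (ltW s0) s1 ts.
apply: (causal_measure_neq0 _ _ (tagged_digits_causal s) t c B t0 hc _ ht) => a.
by apply: B0B; exists a.
Qed.
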